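(* Let $\tau>0$, let $M$ be a symmetric positive definite real $N\times N$ matrix, let $A$ be a symmetric positive semidefinite real $N\times N$ matrix, and let $F\in\mathbb{R}^N$. Let $\mu,\sigma\in\mathbb{R}$ satisfy $\mu\ge \frac12$ and $\sigma\ge\frac{1-\mu}{2}$, and let $(u^n)_{n\ge 0}$ be a sequence in $\mathbb{R}^N$ satisfying the three-level scheme $$M\left(\mu\,\frac{u^{n+1}-u^n}{\tau}+(1-\mu)\,\frac{u^n-u^{n-1}}{\tau}\right)+A\left(\Big(\sigma+\mu-\tfrac12\Big)u^{n+1}-\Big(2\sigma+\mu-\tfrac32\Big)u^n+\sigma u^{n-1}\right)=F,\qquad n=1,2,\dots$$ Put $$S^{Im}=\frac1\tau\Big(\mu-\frac12\Big)M+\Big(\sigma+\frac{\mu-1}{2}\Big)A .$$ Then the scheme is stable in the sense that, for every $n\ge 1$, $$\frac14\|u^{n+1}+u^n\|_A^2+\|u^{n+1}-u^n\|_{S^{Im}}^2\le \frac14\|u^n+u^{n-1}\|_A^2+\|u^n-u^{n-1}\|_{S^{Im}}^2+\frac{\tau}{2}\,\|F\|_{M^{-1}}^2 .$$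
   Context: $(\cdot,\cdot)$ is the Euclidean inner product on $\mathbb{R}^N$. For a symmetric positive semidefinite matrix $B$, $\|v\|_B^2:=(Bv,v)$ (a seminorm in general). $\tau$ is the uniform time step and $u^n$ is the approximation at time $t_n=n\tau$ for the semi-discrete system $M\,\partial_t u+Au=F$ obtained from the space discretization of a multicontinuum flow problem. *)

(* Defs.v *)
From HB Require Import structures.
From mathcomp Require Import all_boot all_order all_algebra.
From mathcomp Require Import sesquilinear reals.

Set Implicit Arguments.
Unset Strict Implicit.
Unset Printing Implicit Defensive.

Import Order.TTheory GRing.Theory Num.Theory.
Local Open Scope ring_scope.

Definition dotcv (R : realType) (N : nat) (v w : 'cV[R]_N) : R :=
  \sum_(i < N) v i 0 * w i 0.

Definition psdmx (R : realType) (N : nat) (B : 'M[R]_N) : Prop :=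
  B \is symmetricmx /\ forall v : 'cV[R]_N, 0 <= dotcv (B *m v) v.

Definition posdefmx (R : realType) (N : nat) (B : 'M[R]_N) : Prop :=
  B \is symmetricmx /\ forall v : 'cV[R]_N, v != 0 -> 0 < dotcv (B *m v) v.

(* The squared seminorm ||v||_B^2. It is total in B, but only meaningful for
   psdmx B; see psdmx_invmx and psdmx_SIm below. *)
Definition sqnorm (R : realType) (N : nat) (B : 'M[R]_N) (v : 'cV[R]_N) : R :=
  dotcv (B *m v) v.

Definition SIm (R : realType) (N : nat) (tau mu sigma : R) (M A : 'M[R]_N) :
    'M[R]_N :=
  (tau^-1 * (mu - 2^-1)) *: M + (sigma + (mu - 1) / 2) *: A.

(* u n.-1 is u^{n-1}: the index n is at least 1, so .-1 never truncates. *)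
Definition three_level_scheme (R : realType) (N : nat) (tau mu sigma : R)
    (M A : 'M[R]_N) (F : 'cV[R]_N) (u : nat -> 'cV[R]_N) : Prop :=
  forall n : nat, (1 <= n)%N ->
    M *m (mu *: (tau^-1 *: (u n.+1 - u n))
          + (1 - mu) *: (tau^-1 *: (u n - u n.-1)))
    + A *m ((sigma + mu - 2^-1) *: u n.+1
            - (2 * sigma + mu - 3 / 2) *: u n
            + sigma *: u n.-1)
    = F.

Lemma symmxP (R : realType) (N : nat) (B : 'M[R]_N) :
  reflect (B^T = B) (B \is symmetricmx).
Proof.
rewrite qualifE /= expr0 scale1r map_mx_id //.
by apply: (iffP eqP) => [<-|->].
Qed.

Lemma dotcvDl (R : realType) (N : nat) (v w x : 'cV[R]_N) :
  dotcv (v + w) x = dotcv v x + dotcv w x.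
Proof.
by rewrite -big_split; apply: eq_bigr => i _; rewrite mxE mulrDl.
Qed.

Lemma dotcvZl (R : realType) (N : nat) (a : R) (v x : 'cV[R]_N) :
  dotcv (a *: v) x = a * dotcv v x.
Proof.
by rewrite mulr_sumr; apply: eq_bigr => i _; rewrite mxE mulrA.
Qed.

Lemma dotcvC (R : realType) (N : nat) (v w : 'cV[R]_N) : dotcv v w = dotcv w v.
Proof. by apply: eq_bigr => i _; rewrite mulrC. Qed.

Lemma posdefmx_psdmx (R : realType) (N : nat) (B : 'M[R]_N) :
  posdefmx B -> psdmx B.
Proof.
case=> sB pB; split=> // v; have [->|/pB/ltW //] := eqVneq v 0.
by rewrite mulmx0 /dotcv sumr_ge0 // => i _; rewrite mxE mul0r.
Qed.

Lemma posdefmx_unitmx (R : realType) (N : nat) (B : 'M[R]_N) :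
  posdefmx B -> B \in unitmx.
Proof.
case=> /symmxP sB pB; rewrite -row_free_unit -kermx_eq0.
apply/eqP/row_matrixP => i; rewrite row0.
apply/eqP; apply: contraT => ki0.
have k0 : (row i (kermx B))^T != 0 by rewrite -(inj_eq trmx_inj) trmxK trmx0.
have := pB _ k0; rewrite -{1}sB -trmx_mul -row_mul mulmx_ker row0 trmx0.
by rewrite /dotcv big1 ?ltxx // => j _; rewrite mxE mul0r.
Qed.

Lemma psdmx_invmx (R : realType) (N : nat) (M : 'M[R]_N) :
  posdefmx M -> psdmx (invmx M).
Proof.
move=> pM; have uM := posdefmx_unitmx pM.
have [/symmxP sM M_ge0] := posdefmx_psdmx pM.
split=> [|v]; first by apply/symmxP; rewrite trmx_inv sM.
have := M_ge0 (invmx M *m v).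
by rewrite mulmxA mulmxV // mul1mx dotcvC.
Qed.

Lemma psdmx_SIm (R : realType) (N : nat) (tau mu sigma : R) (M A : 'M[R]_N) :
    0 < tau -> posdefmx M -> psdmx A -> 2^-1 <= mu -> (1 - mu) / 2 <= sigma ->
  psdmx (SIm tau mu sigma M A).
Proof.
move=> tau0 /posdefmx_psdmx[/symmxP sM pM] [/symmxP sA pA] hmu hsigma.
split=> [|v].
  by apply/symmxP; rewrite /SIm linearD !linearZ /= sM sA.
rewrite /SIm mulmxDl -!scalemxAl dotcvDl !dotcvZl addr_ge0 // mulr_ge0 //.
  by rewrite mulr_ge0 ?subr_ge0 // invr_ge0 ltW.
by rewrite -[mu - 1]opprB mulNr subr_ge0.
Qed.

(* Main.v *)
(* Test the scheme against w = u^{n+1} - u^{n-1}. With p = u^{n+1} - u^n and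
   q = u^n - u^{n-1}, so that w = p + q, the scheme reads
     M w / (2 tau) + S^{Im} (p - q) + A (u^{n+1} + 2 u^n + u^{n-1}) / 4
       + ((mu - 1/2) / 2) A w = F.
   The second and third terms contribute exactly the increment of the energy,
   the last one is nonnegative, and the Young inequality
     (F, w) <= (tau / 2) ||F||_{M^-1}^2 + ||w||_M^2 / (2 tau)
   is absorbed by the first. *)

Require Import Defs.
From mathcomp Require Import all_boot all_order all_algebra.
From mathcomp Require Import sesquilinear reals.
From mathcomp Require Import ring lra.
Import Order.TTheory GRing.Theory Num.Theory.
Local Open Scope ring_scope.

Lemma dotcvNl [R : realType] [N : nat] (v w : 'cV[R]_N) :
  dotcv (- v) w = - dotcv v w.
Proof. by rewrite -scaleN1r dotcvZl mulN1r. Qed.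

Lemma dotcvDr [R : realType] [N : nat] (v w x : 'cV[R]_N) :
  dotcv v (w + x) = dotcv v w + dotcv v x.
Proof. by rewrite !(dotcvC v) dotcvDl. Qed.

Lemma dotcvZr [R : realType] [N : nat] (a : R) (v w : 'cV[R]_N) :
  dotcv v (a *: w) = a * dotcv v w.
Proof. by rewrite !(dotcvC v) dotcvZl. Qed.

Lemma dotcvNr [R : realType] [N : nat] (v w : 'cV[R]_N) :
  dotcv v (- w) = - dotcv v w.
Proof. by rewrite !(dotcvC v) dotcvNl. Qed.

Lemma dotcv_mulmx [R : realType] [N : nat] [B : 'M[R]_N] (v w : 'cV[R]_N) :
  dotcv (B *m v) w = dotcv v (B^T *m w).
Proof.
have dotE (x y : 'cV[R]_N) : dotcv x y = (x^T *m y) 0 0.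
  by rewrite mxE; apply: eq_bigr => i _; rewrite mxE.
by rewrite !dotE trmx_mul mulmxA.
Qed.

Lemma dotcv_symmx [R : realType] [N : nat] [B : 'M[R]_N] (v w : 'cV[R]_N) :
  B \is symmetricmx -> dotcv (B *m v) w = dotcv (B *m w) v.
Proof. by move=> /symmxP sB; rewrite dotcv_mulmx sB dotcvC. Qed.

Definition dotcv_linear := (mulmxDr, mulmxN, =^~ scalemxAr, dotcvDl, dotcvDr,
  dotcvNl, dotcvNr, dotcvZl, dotcvZr).

(** With [G = invmx M *m F], the right side minus the left is the square
    [sqnorm M (w - tau *: G) / (2 * tau)]. *)
Lemma dotcv_young [R : realType] [N : nat] [tau : R] [M : 'M[R]_N]
    (F w : 'cV[R]_N) : 0 < tau -> posdefmx M ->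
  dotcv F w <= tau / 2 * sqnorm (invmx M) F + (2 * tau)^-1 * sqnorm M w.
Proof.
move=> tau0 pM; have [sM M_ge0] := posdefmx_psdmx pM.
have MK : M *m (invmx M *m F) = F by rewrite mulKVmx // posdefmx_unitmx.
rewrite /sqnorm; set G := invmx M *m F in MK *.
rewrite -MK -subr_ge0.
have : 0 <= (2 * tau)^-1 * dotcv (M *m (w - tau *: G)) (w - tau *: G).
  by rewrite mulr_ge0 // invr_ge0 mulr_ge0 // ltW.
congr (0 <= _); rewrite !dotcv_linear (dotcv_symmx w G sM) (dotcvC G).
by field; rewrite gt_eqF.
Qed.

(** Here [x], [y], [z] stand for three consecutive time levels. By symmetry the increments are
    differences of squares: [x - z] is both [(x - y) + (y - z)] and [(x + y) - (y + z)]. *)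
Lemma three_level_energy [R : realType] [N : nat] (tau mu sigma : R)
    (M A : 'M[R]_N) (x y z : 'cV[R]_N) :
  tau != 0 -> M \is symmetricmx -> A \is symmetricmx ->
  dotcv (M *m (mu *: (tau^-1 *: (x - y)) + (1 - mu) *: (tau^-1 *: (y - z)))
         + A *m ((sigma + mu - 2^-1) *: x - (2 * sigma + mu - 3 / 2) *: y
                 + sigma *: z)) (x - z)
  = (4^-1 * sqnorm A (x + y) + sqnorm (SIm tau mu sigma M A) (x - y))
    - (4^-1 * sqnorm A (y + z) + sqnorm (SIm tau mu sigma M A) (y - z))
    + (2 * tau)^-1 * sqnorm M (x - z) + (mu - 2^-1) / 2 * sqnorm A (x - z).
Proof.
move=> tau0 sM sA; rewrite /sqnorm /SIm !mulmxDl -!scalemxAl !dotcv_linear.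
(* Each mixed pairing gets one orientation, so that [field] sees equal pairings as the same atom. *)
rewrite !(dotcv_symmx y x sM, dotcv_symmx z x sM, dotcv_symmx z y sM).
rewrite !(dotcv_symmx y x sA, dotcv_symmx z x sA, dotcv_symmx z y sA).
by field.
Qed.

Theorem theorem2 (R : realType) (N : nat) (tau : R) (M A : 'M[R]_N)
    (F : 'cV[R]_N) (mu sigma : R) (u : nat -> 'cV[R]_N) :
  0 < tau ->
  posdefmx M ->
  psdmx A ->
  2^-1 <= mu ->
  (1 - mu) / 2 <= sigma ->
  three_level_scheme tau mu sigma M A F u ->
  forall n : nat, (1 <= n)%N ->
    4^-1 * sqnorm A (u n.+1 + u n)
      + sqnorm (SIm tau mu sigma M A) (u n.+1 - u n)
    <= 4^-1 * sqnorm A (u n + u n.-1)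
      + sqnorm (SIm tau mu sigma M A) (u n - u n.-1)
      + tau / 2 * sqnorm (invmx M) F.
Proof.
move=> tau0 pM [sA A_ge0] hmu _ scheme n n1.
have [sM _] := posdefmx_psdmx pM.
have := dotcv_young F (u n.+1 - u n.-1) tau0 pM.
(* Only the [F] paired with the test vector is replaced; the one in the [invmx M] norm stays. The
   [sqnorm M] terms on the two sides then cancel. *)
rewrite -{1}(scheme n n1) three_level_energy ?gt_eqF //.
have : 0 <= (mu - 2^-1) / 2 * sqnorm A (u n.+1 - u n.-1).
  by apply: mulr_ge0; [lra | exact: A_ge0].
lra.
Qed.
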